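(* Let $n$ be a positive integer and let $R$ be a ring. Then there is a lattice isomorphism between the lattice of two-sided ideals of $R$ and the lattice of two-sided ideals of $MC_n(R)$.
   Context: All rings are associative with $1$. $M_m(R)$ is the ring of $m\times m$ matrices over $R$. Identify $M_n(M_{n^k}(R))$ with $M_{n^{k+1}}(R)$ via block matrices. The $n$-matricial closure $MC_n(R)$ is the direct limit of the rings $M_{n^k}(R)$, $k\in\mathbb{N}=\{0,1,2,\dots\}$ (with $M_{n^0}(R)=R$), along the injective ring morphisms $M_{n^k}(R)\to M_{n^{k+1}}(R)$ sending $A$ to the block diagonal matrix with $n$ diagonal blocks equal to $A$. *)

(* Defs.v *)
From HB Require Import structures.
From mathcomp Require Import all_boot all_order all_algebra.
From mathcomp Require Import boolp classical_sets.
From mathcomp Require Import zify.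

Set Implicit Arguments.
Unset Strict Implicit.
Unset Printing Implicit Defensive.

Import GRing.Theory.
Local Open Scope ring_scope.
Local Open Scope quotient_scope.

(* Rings are [pzRingType]s: associative with 1, not necessarily commutative,
   the zero ring being allowed.

   The ideals of [ring_quotient] are proper and one-sided, hence the notion
   below.  The underlying set is a classical predicate, so [tsideal R] is the
   type of all two-sided ideals of R, including R itself. *)
Definition is_tsideal (R : pzRingType) (I : set R) : Prop :=
  [/\ I 0,
      forall x y, I x -> I y -> I (x - y)
    & forall a x, I x -> I (a * x) /\ I (x * a)].

Record tsideal (R : pzRingType) := TSIdeal {
  tsideal_set :> set R;
  tsideal_setP : `[< is_tsideal tsideal_set >]
}.

HB.instance Definition _ (R : pzRingType) := [isSub for @tsideal_set R].
HB.instance Definition _ (R : pzRingType) := [Choice of tsideal R by <:].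

Section IdealLattice.
Variable R : pzRingType.
Implicit Types I J K : tsideal R.
Local Open Scope classical_set_scope.

Lemma tsidealP I : is_tsideal I.
Proof. exact/asboolP/tsideal_setP. Qed.

Lemma tsideal_eqP I J : I `<=>` J -> I = J.
Proof. by move=> [IJ JI]; apply/val_inj/seteqP. Qed.

Lemma tsidealI_subproof I J : `[< is_tsideal (I `&` J) >].
Proof.
have [I0 IB IM] := tsidealP I; have [J0 JB JM] := tsidealP J.
apply/asboolP; split=> [|x y [xI xJ] [yI yJ]|a x [xI xJ]]; first by split.
  by split; [apply: IB | apply: JB].
by have [? ?] := IM a x xI; have [? ?] := JM a x xJ.
Qed.

Definition tsidealI I J : tsideal R := TSIdeal (tsidealI_subproof I J).

Lemma tsidealD_subproof I J :
  `[< is_tsideal [set x + y | x in I & y in J] >].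
Proof.
have [I0 IB IM] := tsidealP I; have [J0 JB JM] := tsidealP J.
apply/asboolP; split.
- by exists 0 => //; exists 0; rewrite ?addr0.
- move=> _ _ [x xI [y yJ <-]] [x' x'I [y' y'J <-]].
  by exists (x - x'); [exact: IB | exists (y - y'); [exact: JB|]];
    rewrite opprD addrACA.
- move=> a _ [x xI [y yJ <-]].
  have [axI xaI] := IM a x xI; have [ayJ yaJ] := JM a y yJ; split.
    by exists (a * x) => //; exists (a * y) => //; rewrite mulrDr.
  by exists (x * a) => //; exists (y * a) => //; rewrite mulrDl.
Qed.

Definition tsidealD I J : tsideal R := TSIdeal (tsidealD_subproof I J).

Definition tsideal_le I J : bool := `[< I `<=` J >].

Lemma tsideal_le_refl : reflexive tsideal_le.
Proof. by move=> I; apply/asboolP. Qed.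

Lemma tsideal_le_anti : antisymmetric tsideal_le.
Proof.
by move=> I J /andP[/asboolP IJ /asboolP JI]; apply: tsideal_eqP.
Qed.

Lemma tsideal_le_trans : transitive tsideal_le.
Proof.
move=> J I K /asboolP IJ /asboolP JK; apply/asboolP.
exact: subset_trans IJ JK.
Qed.

Lemma tsideal_lexI I J K :
  tsideal_le I (tsidealI J K) = tsideal_le I J && tsideal_le I K.
Proof.
apply/asboolP/andP => [IJK|[/asboolP IJ /asboolP IK] x xI].
  by split; apply/asboolP => x /IJK[].
by split; [apply: IJ | apply: IK].
Qed.

Lemma tsideal_leUx I J K :
  tsideal_le (tsidealD I J) K = tsideal_le I K && tsideal_le J K.
Proof.
have [I0 _ _] := tsidealP I; have [J0 _ _] := tsidealP J.
have [K0 KB _] := tsidealP K.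
apply/asboolP/andP => [IJK|[/asboolP IK /asboolP JK] _ [x xI [y yJ <-]]].
  split; apply/asboolP => x xI; apply: IJK.
    by exists x => //; exists 0; rewrite ?addr0.
  by exists 0 => //; exists x; rewrite ?add0r.
rewrite -[y]opprK -[- y]sub0r.
by apply: (KB) (IK _ xI) _; apply: KB (JK _ yJ).
Qed.

End IdealLattice.

Fact tsideal_display : Order.disp_t. Proof. exact: (Order.Disp tt tt). Qed.

HB.instance Definition _ (R : pzRingType) :=
  Order.Le_isPOrder.Build tsideal_display (tsideal R)
    (@tsideal_le_refl R) (@tsideal_le_anti R) (@tsideal_le_trans R).
HB.instance Definition _ (R : pzRingType) :=
  Order.POrder_MeetJoin_isLattice.Build tsideal_display (tsideal R)
    (@tsideal_lexI R) (@tsideal_leUx R).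

(* Direct limit of A 0 -> A 1 -> A 2 -> ... : the disjoint union of the A k,
   two elements being identified when they have a common image further on. *)
Section DirectLimit.
Variables (A : nat -> pzRingType) (f : forall k, {rmorphism A k -> A k.+1}).

Local Notation T := {k : nat & A k}.

Definition dl_step (u : T) : T := Tagged (fun k => A k) (f _ (tagged u)).

Definition dl_rel (u v : T) : bool :=
  `[< exists p q, iter p dl_step u = iter q dl_step v >].

Lemma dl_rel_refl : reflexive dl_rel.
Proof. by move=> u; apply/asboolP; exists 0%N, 0%N. Qed.

Lemma dl_rel_sym : symmetric dl_rel.
Proof. by move=> u v; apply/asboolP/asboolP => -[p [q e]]; exists q, p. Qed.

Lemma dl_rel_trans : transitive dl_rel.
Proof.
move=> v u w /asboolP[p [q e]] /asboolP[r [s e']]; apply/asboolP.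
by exists (r + p)%N, (q + s)%N; rewrite iterD e -iterD addnC iterD e' -iterD.
Qed.

Canonical dl_equiv := EquivRel dl_rel dl_rel_refl dl_rel_sym dl_rel_trans.

Definition dirlim : Type := {eq_quot dl_equiv}.
HB.instance Definition _ := Choice.on dirlim.
HB.instance Definition _ := EqQuotient.on dirlim.

Definition dl_in (k : nat) (a : A k) : dirlim :=
  \pi_dirlim (Tagged (fun k => A k) a).

(* u is pushed tag v steps and v is pushed tag u steps; both results live in
   A (tag u + tag v), and [tagged_as] is the corresponding transport. *)
Definition dl_op2 (op : forall k, A k -> A k -> A k) (u v : T) : T :=
  let u' := iter (tag v) dl_step u in
  let v' := iter (tag u) dl_step v in
  Tagged (fun k => A k) (op _ (tagged u') (tagged_as u' v')).

Definition dl_zero : dirlim := dl_in (0 : A 0).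
Definition dl_one : dirlim := dl_in (1 : A 0).
Definition dl_opp (x : dirlim) : dirlim := dl_in (- tagged (repr x)).
Definition dl_add (x y : dirlim) : dirlim :=
  \pi_dirlim (dl_op2 (fun k => +%R) (repr x) (repr y)).
Definition dl_mul (x y : dirlim) : dirlim :=
  \pi_dirlim (dl_op2 (fun k => *%R) (repr x) (repr y)).

Lemma dl_tag_iter p u : tag (iter p dl_step u) = (p + tag u)%N.
Proof. by elim: p => //= p ->. Qed.

Lemma dl_inS k (a : A k) : dl_in (f k a) = dl_in a.
Proof. by apply/eqmodP/asboolP; exists 0%N, 1%N. Qed.

Lemma dl_pi_iter p u : \pi_dirlim (iter p dl_step u) = \pi_dirlim u.
Proof. by apply/eqmodP/asboolP; exists 0%N, p. Qed.

Lemma dl_inP (x : dirlim) : exists k (a : A k), x = dl_in a.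
Proof. by exists (tag (repr x)), (tagged (repr x)); rewrite /dl_in taggedK reprK. Qed.

Lemma dl_in_eq k (a b : A k) : dl_in a = dl_in b ->
  exists p, iter p dl_step (Tagged (fun k => A k) a)
          = iter p dl_step (Tagged (fun k => A k) b).
Proof.
move=> /eqmodP/asboolP[p [q e]]; exists p.
have := congr1 (@tag _ _) e; rewrite !dl_tag_iter /= => /addIn pq.
by rewrite {2}pq.
Qed.

Lemma dl_raise (u : T) m : (tag u <= m)%N ->
  exists a : A m, iter (m - tag u) dl_step u = Tagged (fun k => A k) a.
Proof.
move=> um; have := dl_tag_iter (m - tag u) u; rewrite subnK //.
by case: (iter _ _ _) => m' a /= e; subst m'; exists a.
Qed.

Lemma dl_in2 (x y : dirlim) : exists k (a b : A k), x = dl_in a /\ y = dl_in b.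
Proof.
have [a ea] := dl_raise (leq_maxl (tag (repr x)) (tag (repr y))).
have [b eb] := dl_raise (leq_maxr (tag (repr x)) (tag (repr y))).
exists (maxn (tag (repr x)) (tag (repr y))), a, b.
by rewrite /dl_in -ea -eb !dl_pi_iter !reprK.
Qed.

Lemma dl_in3 (x y z : dirlim) : exists k (a b c : A k),
  [/\ x = dl_in a, y = dl_in b & z = dl_in c].
Proof.
set m := maxn (tag (repr x)) (maxn (tag (repr y)) (tag (repr z))).
have [|a ea] := @dl_raise (repr x) m; first exact: leq_maxl.
have [|b eb] := @dl_raise (repr y) m; first by rewrite !leq_max leqnn orbT.
have [|c ec] := @dl_raise (repr z) m; first by rewrite !leq_max leqnn !orbT.
by exists m, a, b, c; rewrite /dl_in -ea -eb -ec !dl_pi_iter !reprK.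
Qed.

Section Op2.
Variable op : forall k, A k -> A k -> A k.
Hypothesis fop : forall k, {morph f k : a b / op a b}.
Local Notation TA := (Tagged (fun k => A k)).

Lemma dl_iter_op p k (a b : A k) : exists l (a' b' : A l),
  [/\ iter p dl_step (TA a) = TA a', iter p dl_step (TA b) = TA b'
    & iter p dl_step (TA (op a b)) = TA (op a' b')].
Proof.
elim: p => [|p [l [a' [b' [ea eb eab]]]]]; first by exists k, a, b.
by exists l.+1, (f l a'), (f l b'); rewrite !iterS ea eb eab /dl_step /= fop.
Qed.

Lemma dl_op2E (u v : T) k (a b : A k) :
  \pi_dirlim u = dl_in a -> \pi_dirlim v = dl_in b ->
  \pi_dirlim (dl_op2 op u v) = dl_in (op a b).
Proof.
move=> /eqmodP/asboolP[p [p' eu]] /eqmodP/asboolP[q [q' ev]].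
have [a0 [b0 [eu0 ev0 ->]]] : exists (a0 b0 : A (tag v + tag u)%N),
    [/\ iter (tag v) dl_step u = TA a0, iter (tag u) dl_step v = TA b0
      & dl_op2 op u v = TA (op a0 b0)].
  rewrite /dl_op2; have := dl_tag_iter (tag v) u; have := dl_tag_iter (tag u) v.
  case: (iter (tag v) _ _) => m a0; case: (iter (tag u) _ _) => m' b0 /=.
  rewrite addnC => em' em; subst m m'; exists a0, b0; split=> //.
  by rewrite tagged_asE.
have tu := congr1 (@tag _ _) eu; have tv := congr1 (@tag _ _) ev.
rewrite !dl_tag_iter /= in tu tv.
set N := (tag v + tag u)%N in a0 b0 eu0 ev0 *.
apply/eqmodP/asboolP; exists (p + q + k)%N, (p + q + N)%N.
have [l [a1 [b1 [e1 e2 ->]]]] := dl_iter_op (p + q + k) a0 b0.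
have [l' [a2 [b2 [e3 e4 ->]]]] := dl_iter_op (p + q + N) a b.
have ea : TA a1 = TA a2.
  rewrite -e1 -e3 -eu0 -iterD.
  have -> : (p + q + k + tag v = (q + k + tag v) + p)%N by rewrite /N; lia.
  by rewrite iterD eu -iterD; congr iter; rewrite /N; lia.
have eb : TA b1 = TA b2.
  rewrite -e2 -e4 -ev0 -iterD.
  have -> : (p + q + k + tag u = (p + k + tag u) + q)%N by lia.
  by rewrite iterD ev -iterD; congr iter; rewrite /N; lia.
have ell : l = l' := congr1 (@tag _ _) ea.
subst l'.
by move/eqP: ea; rewrite eq_Tagged => /eqP /= ->; move/eqP: eb;
   rewrite eq_Tagged => /eqP /= ->.
Qed.

End Op2.

Lemma dl_in_add k : {morph @dl_in k : a b / a + b >-> dl_add a b}.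
Proof.
move=> a b; apply/esym/(@dl_op2E (fun k => +%R)); rewrite ?reprK //.
by move=> l; exact: rmorphD.
Qed.

Lemma dl_in_mul k : {morph @dl_in k : a b / a * b >-> dl_mul a b}.
Proof.
move=> a b; apply/esym/(@dl_op2E (fun k => *%R)); rewrite ?reprK //.
by move=> l; exact: rmorphM.
Qed.

Lemma dl_in_zero k : dl_in (0 : A k) = dl_zero.
Proof. by elim: k => // k IHk; rewrite -(rmorph0 (f k)) dl_inS. Qed.

Lemma dl_in_one k : dl_in (1 : A k) = dl_one.
Proof. by elim: k => // k IHk; rewrite -(rmorph1 (f k)) dl_inS. Qed.

Lemma dl_addA : associative dl_add.
Proof.
move=> x y z; have [k [a [b [c [-> -> ->]]]]] := dl_in3 x y z.
by rewrite -!dl_in_add addrA.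
Qed.

Lemma dl_addC : commutative dl_add.
Proof.
by move=> x y; have [k [a [b [-> ->]]]] := dl_in2 x y; rewrite -!dl_in_add addrC.
Qed.

Lemma dl_add0 : left_id dl_zero dl_add.
Proof.
by move=> x; have [k [a ->]] := dl_inP x; rewrite -(dl_in_zero k) -dl_in_add add0r.
Qed.

Lemma dl_addN : left_inverse dl_zero dl_opp dl_add.
Proof.
move=> x; rewrite -[X in dl_add _ X]reprK -[repr x in X in dl_add _ X]taggedK.
by rewrite -[X in dl_add _ X]/(dl_in _) -dl_in_add addNr dl_in_zero.
Qed.

HB.instance Definition _ :=
  GRing.isZmodule.Build dirlim dl_addA dl_addC dl_add0 dl_addN.

Lemma dl_mulA : associative dl_mul.
Proof.
move=> x y z; have [k [a [b [c [-> -> ->]]]]] := dl_in3 x y z.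
by rewrite -!dl_in_mul mulrA.
Qed.

Lemma dl_mul1 : left_id dl_one dl_mul.
Proof.
by move=> x; have [k [a ->]] := dl_inP x; rewrite -(dl_in_one k) -dl_in_mul mul1r.
Qed.

Lemma dl_mulr1 : right_id dl_one dl_mul.
Proof.
by move=> x; have [k [a ->]] := dl_inP x; rewrite -(dl_in_one k) -dl_in_mul mulr1.
Qed.

Lemma dl_mulDl : left_distributive dl_mul dl_add.
Proof.
move=> x y z; have [k [a [b [c [-> -> ->]]]]] := dl_in3 x y z.
by rewrite -!(dl_in_add, dl_in_mul) mulrDl.
Qed.

Lemma dl_mulDr : right_distributive dl_mul dl_add.
Proof.
move=> x y z; have [k [a [b [c [-> -> ->]]]]] := dl_in3 x y z.
by rewrite -!(dl_in_add, dl_in_mul) mulrDr.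
Qed.

HB.instance Definition _ := GRing.Zmodule_isPzRing.Build dirlim
  dl_mulA dl_mul1 dl_mulr1 dl_mulDl dl_mulDr.

Lemma dl_in_is_zmod_morphism k : zmod_morphism (@dl_in k).
Proof.
move=> a b; have Nb : dl_in (- b) = - dl_in b.
  by apply/eqP; rewrite -addr_eq0 -[_ + _]dl_in_add addNr dl_in_zero.
by rewrite -Nb dl_in_add.
Qed.
HB.instance Definition _ k :=
  GRing.isZmodMorphism.Build (A k) dirlim (@dl_in k) (@dl_in_is_zmod_morphism k).

Lemma dl_in_is_monoid_morphism k : monoid_morphism (@dl_in k).
Proof. by split; [exact: dl_in_one | exact: dl_in_mul]. Qed.
HB.instance Definition _ k :=
  GRing.isMonoidMorphism.Build (A k) dirlim (@dl_in k)
    (@dl_in_is_monoid_morphism k).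

(* Universal property; uniqueness of h is [dl_inP]. *)
Lemma dirlim_universal (B : pzRingType) (g : forall k, {rmorphism A k -> B}) :
  (forall k a, g k.+1 (f k a) = g k a) ->
  exists h : {rmorphism dirlim -> B}, forall k a, h (@dl_in k a) = g k a.
Proof.
move=> gf; pose G (u : T) := g _ (tagged u).
have Giter p u : G (iter p dl_step u) = G u.
  by elim: p => //= p <-; exact: gf.
pose h (x : dirlim) := G (repr x).
have hE k a : h (@dl_in k a) = g k a.
  have : \pi_dirlim (repr (dl_in a)) = dl_in a by rewrite reprK.
  move=> /eqmodP/asboolP[p [q e]].
  by rewrite /h -(Giter p) e Giter.
have hB : zmod_morphism h.
  move=> x y; have [k [a [b [-> ->]]]] := dl_in2 x y.
  by rewrite -rmorphB !hE rmorphB.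
have hM : monoid_morphism h.
  split=> [|x y]; first by rewrite -(rmorph1 (@dl_in 0)) hE rmorph1.
  have [k [a [b [-> ->]]]] := dl_in2 x y.
  by rewrite -rmorphM !hE rmorphM.
pose hZ := GRing.isZmodMorphism.Build _ _ h hB.
pose hR := GRing.isMonoidMorphism.Build _ _ h hM.
pose H : {rmorphism dirlim -> B} := HB.pack h hZ hR.
by exists H.
Qed.

End DirectLimit.

Section MatricialClosure.
Variables (n : nat) (R : pzRingType).

Lemma blockdiag_size k : (\sum_(i < n) n ^ k = n ^ k.+1)%N.
Proof. by rewrite sum_nat_const card_ord expnS. Qed.

Definition blockdiag (k : nat) (A : 'M[R]_(n ^ k)) : 'M[R]_(n ^ k.+1) :=
  castmx (blockdiag_size k, blockdiag_size k) (\mxdiag_(i < n) A).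

Lemma blockdiag_is_zmod_morphism k : zmod_morphism (@blockdiag k).
Proof. by move=> A B; rewrite /blockdiag mxdiagB; case: _ / (blockdiag_size k). Qed.
HB.instance Definition _ k :=
  GRing.isZmodMorphism.Build 'M[R]_(n ^ k) 'M[R]_(n ^ k.+1) (@blockdiag k)
    (@blockdiag_is_zmod_morphism k).

Lemma blockdiag_is_monoid_morphism k : monoid_morphism (@blockdiag k).
Proof.
rewrite /blockdiag; split=> [|A B].
  by rewrite mxdiagZ; case: _ / (blockdiag_size k).
transitivity (castmx (blockdiag_size k, blockdiag_size k)
    ((\mxdiag_(i < n) A) *m (\mxdiag_(i < n) B))); last first.
  by case: _ / (blockdiag_size k).
congr castmx; rewrite [in X in _ = _ *m X]/mxdiag mul_mxdiag_mxblock.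
by apply/eq_mxblock => i j; case: eqP => [e|]; rewrite ?mulmx0 ?conform_mx_id.
Qed.
HB.instance Definition _ k :=
  GRing.isMonoidMorphism.Build 'M[R]_(n ^ k) 'M[R]_(n ^ k.+1) (@blockdiag k)
    (@blockdiag_is_monoid_morphism k).

(* The first term of the system is 'M[R]_(n ^ 0), the ring of 1 x 1 matrices,
   in place of R. *)
Definition MC : pzRingType :=
  dirlim (A := fun k => 'M[R]_(n ^ k)) (fun k => @blockdiag k).

End MatricialClosure.

(* Main.v *)
(* A two-sided ideal of a matrix ring consists of the matrices with entries in
   an ideal of the base ring: [A i j] is recovered from A by multiplying with
   matrix units on both sides.  Since A and its block diagonal image have the
   same entries up to 0, this description passes to the limit. *)
From HB Require Import structures.
Require Import Defs.
From mathcomp Require Import all_boot all_order all_algebra.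
From mathcomp Require Import boolp classical_sets.

Set Implicit Arguments.
Unset Strict Implicit.
Unset Printing Implicit Defensive.

Import Order.Theory GRing.Theory.
Local Open Scope ring_scope.

(** Mutually inverse monotone maps are adjoint to each other on both sides, so [f] preserves meets
    as a right adjoint and joins as a left adjoint. *)
Lemma order_iso_lmorphism (d d' : Order.disp_t) (L : latticeType d)
    (L' : latticeType d') (f : L -> L') (g : L' -> L) :
    {homo f : x y / (x <= y)%O} -> {homo g : x y / (x <= y)%O} ->
    cancel f g -> cancel g f ->
  exists h : {lmorphism L -> L'}, bijective h.
Proof.
move=> f_homo g_homo fK gK.
have le_fg x y : (f x <= y)%O = (x <= g y)%O.
  by apply/idP/idP => [/g_homo|/f_homo]; rewrite ?fK ?gK.
have le_gf x y : (x <= f y)%O = (g x <= y)%O.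
  by apply/idP/idP => [/g_homo|/f_homo]; rewrite ?fK ?gK.
have fI : Order.meet_morphism f.
  move=> x y; apply/le_anti/andP; split.
    by rewrite lexI !f_homo ?leIl ?leIr.
  by rewrite le_gf lexI -!le_gf leIl leIr.
have fU : Order.join_morphism f.
  move=> x y; apply/le_anti/andP; split; last first.
    by rewrite leUx !f_homo ?leUl ?leUr.
  by rewrite le_fg leUx -!le_fg leUl leUr.
pose fO := Order.isOrderMorphism.Build d L d' L' f f_homo.
pose fM := Order.isMeetLatticeMorphism.Build d L d' L' f fI.
pose fJ := Order.isJoinLatticeMorphism.Build d L d' L' f fU.
pose h : {lmorphism L -> L'} := HB.pack f fO fM fJ.
by exists h, g.
Qed.

Section TwoSidedIdeals.
Variables (R : pzRingType) (I : set R).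
Hypothesis idI : is_tsideal I.

Lemma is_tsideal0 : I 0.
Proof. by have [] := idI. Qed.

Lemma is_tsidealMl a x : I x -> I (a * x).
Proof. by have [_ _ IM] := idI; move=> /(IM a)[]. Qed.

Lemma is_tsidealMr a x : I x -> I (x * a).
Proof. by have [_ _ IM] := idI; move=> /(IM a)[]. Qed.

Lemma is_tsidealD x y : I x -> I y -> I (x + y).
Proof.
(* Only differences are given by the definition, so the sum is written [x - (0 - y)]. *)
have [I0 IB _] := idI; move=> xI yI; rewrite -[y]opprK -[- y]sub0r.
by apply: (IB) (xI) _; exact: IB.
Qed.

Lemma is_tsideal_sum (T : Type) (r : seq T) (P : pred T) (F : T -> R) :
  (forall i, P i -> I (F i)) -> I (\sum_(i <- r | P i) F i).
Proof. by move=> IF; elim/big_ind: _ => //; [exact: is_tsideal0|exact: is_tsidealD]. Qed.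

End TwoSidedIdeals.

Lemma is_tsideal_preimage (S S' : pzRingType) (f : {rmorphism S -> S'})
    (J : set S') : is_tsideal J -> is_tsideal (f @^-1` J)%classic.
Proof.
case=> J0 JB JM; split=> /= [|x y xJ yJ|a x xJ]; first by rewrite /= rmorph0.
  by rewrite /= rmorphB; exact: JB.
by rewrite /= !rmorphM; exact: JM.
Qed.

(** Rectangular sizes allow the two equations of a [castmx] to be eliminated separately. *)
Definition mx_in (R : Type) (I : set R) p q (A : 'M[R]_(p, q)) : Prop :=
  forall i j, I (A i j).

Lemma mx_in_castmx (R : Type) (I : set R) p q p' q' (e : (p = p') * (q = q'))
    (A : 'M[R]_(p, q)) : mx_in I (castmx e A) <-> mx_in I A.
Proof. by case: e => e e'; case: _ / e; case: _ / e'; rewrite castmx_id. Qed.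

Lemma is_tsideal_mx_in (R : pzRingType) (I : set R) m :
  is_tsideal I -> is_tsideal (@mx_in R I m m).
Proof.
move=> idI; have [I0 IB _] := idI.
split=> [i j|A B AI BI i j|A B BI]; [by rewrite mxE|by rewrite !mxE; exact: IB|].
by split=> i j; rewrite mxE; apply: (is_tsideal_sum idI) => k _;
  [exact: is_tsidealMl | exact: is_tsidealMr].
Qed.

Lemma delta_mx_mul_delta (R : pzRingType) m (A : 'M[R]_m) (i j l : 'I_m) :
  delta_mx l i *m A *m delta_mx j l = A i j *: delta_mx l l.
Proof.
apply/matrixP => s t; rewrite !mxE (bigD1 j) //= big1 ?addr0; last first.
  by move=> u /negPf uj; rewrite [delta_mx _ _ _ _]mxE uj mulr0.
rewrite !mxE eqxx (bigD1 i) //= big1 ?addr0; last first.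
  by move=> u /negPf ui; rewrite mxE ui andbF mul0r.
rewrite mxE eqxx andbT; case: (s == l); case: (t == l);
  by rewrite ?mul1r ?mul0r ?mulr1 ?mulr0.
Qed.

(** The base ideal is read off from scalar matrices rather than from a fixed entry, because
    [blockdiag] preserves them and the description is then the same at every level. *)
Lemma is_tsideal_mxP (R : pzRingType) m (J : set 'M[R]_m) (A : 'M[R]_m) :
  is_tsideal J -> J A <-> mx_in [set r | J r%:M] A.
Proof.
move=> idJ; split=> [AJ i j /=|AJ].
  (* Each diagonal term is [A] multiplied by matrix units on both sides. *)
  have -> : (A i j)%:M = \sum_l A i j *: delta_mx l l :> 'M[R]_m.
    by rewrite -scaler_sumr -mx1_sum_delta scalemx1.
  apply: (is_tsideal_sum idJ) => l _; rewrite -delta_mx_mul_delta.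
  by apply: is_tsidealMr => //; exact: is_tsidealMl.
rewrite [A]matrix_sum_delta.
apply: (is_tsideal_sum idJ) => i _; apply: (is_tsideal_sum idJ) => j _.
(* Each term is the scalar matrix of an entry, which lies in [J], times a matrix unit. *)
by rewrite -mul_scalar_mx; apply: is_tsidealMr => //; exact: AJ.
Qed.

Lemma blockdiag_scalar (R : pzRingType) n k (r : R) :
  blockdiag (r%:M : 'M_(n ^ k)) = r%:M :> 'M[R]_(n ^ k.+1).
Proof. by rewrite /blockdiag mxdiagZ; case: _ / (blockdiag_size n k). Qed.

Lemma mx_in_blockdiag (R : pzRingType) (I : set R) n k (A : 'M[R]_(n ^ k)) :
  (0 < n)%N -> I 0 -> mx_in I (blockdiag A) <-> mx_in I A.
Proof.
case: n A => // n A _ I0.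
rewrite /blockdiag mx_in_castmx; split=> AI i j.
  (* Positivity of [n] provides a block of index [ord0], from which [A] is recovered. *)
  by rewrite -[A](@submxblock_diag R n.+1 (fun=> _) (fun=> A) ord0) mxE; exact: AI.
rewrite mxE; case: eqP => _; last by rewrite mxE.
by rewrite conform_mx_id; exact: AI.
Qed.

Section IdealCorrespondence.
Variables (n : nat) (R : pzRingType).
Hypothesis n_gt0 : (0 < n)%N.

Definition MC_in k (A : 'M[R]_(n ^ k)) : MC n R :=
  @dl_in (fun k => 'M[R]_(n ^ k)) (fun k => @blockdiag n R k) k A.

Lemma MC_in_scalar k (r : R) : MC_in (r%:M : 'M_(n ^ k)) = MC_in (r%:M : 'M_(n ^ 0)).
Proof.
by elim: k => // k <-; rewrite -(blockdiag_scalar n k); exact: dl_inS.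
Qed.

Definition MC_set (I : set R) : set (MC n R) :=
  [set x | exists k (A : 'M[R]_(n ^ k)), x = MC_in A /\ mx_in I A].

(** Membership does not depend on the representative: two of them have a common iterated image, and
    [blockdiag] preserves and reflects the condition on entries. *)
Lemma mem_MC_set (I : tsideal R) k (A : 'M[R]_(n ^ k)) :
  MC_set I (MC_in A) <-> mx_in I A.
Proof.
split=> [[l [B [+ BI]]]|AI]; last by exists k, A.
move=> /eqmodP/asboolP[p [q e]].
(* Stating the condition on tagged matrices lets [e] be rewritten without transport between
   levels. *)
pose T := {k : nat & 'M[R]_(n ^ k)}; pose P (u : T) := mx_in I (tagged u).
pose step := dl_step (A := fun k => 'M[R]_(n ^ k)) (fun k => @blockdiag n R k).
have P_iter r u : P (iter r step u) <-> P u.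
  elim: r => //= r IHr; apply: iff_trans IHr.
  exact: mx_in_blockdiag n_gt0 (is_tsideal0 (tsidealP I)).
apply: (proj1 (P_iter p (Tagged _ A))); rewrite [iter _ _ _]e.
exact: (proj2 (P_iter q (Tagged _ B))).
Qed.

Lemma MC_set_tsideal (I : tsideal R) : `[< is_tsideal (MC_set I) >].
Proof.
apply/asboolP.
have IP k : is_tsideal (@mx_in R I (n ^ k) (n ^ k)).
  exact/is_tsideal_mx_in/tsidealP.
split=> [|x y|a x].
- by exists 0%N, 0; split; [rewrite /MC_in rmorph0|case: (IP 0%N)].
- have [k [A [B [-> ->]]]] := dl_in2 x y; have [_ IB _] := IP k.
  move=> /mem_MC_set AI /mem_MC_set BI; rewrite -rmorphB.
  by apply/mem_MC_set; exact: IB.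
have [k [A [B [-> ->]]]] := dl_in2 a x; have [_ _ IM] := IP k.
by move=> /mem_MC_set/(IM A)[AB BA]; split; rewrite -rmorphM; apply/mem_MC_set.
Qed.

Definition MC_tsideal (I : tsideal R) : tsideal (MC n R) :=
  TSIdeal (MC_set_tsideal I).

(** This is the contraction of [J] to [R], embedded in the limit as 1 x 1 matrices. *)
Definition base_set (J : set (MC n R)) : set R :=
  [set r | J (MC_in (r%:M : 'M_(n ^ 0)))].

Lemma base_set_tsideal (J : tsideal (MC n R)) : `[< is_tsideal (base_set J) >].
Proof.
have [J0 JB JM] := tsidealP J.
apply/asboolP; split=> /= [|x y xJ yJ|a x xJ].
- by rewrite /base_set /= raddf0 /MC_in rmorph0.
- by rewrite /base_set /= raddfB /MC_in rmorphB; exact: JB.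
by rewrite /base_set /= !scalar_mxM /MC_in !rmorphM; exact: JM.
Qed.

Definition base_tsideal (J : tsideal (MC n R)) : tsideal R :=
  TSIdeal (base_set_tsideal J).

(** The preimage of [J] at level [k] is an ideal of a matrix ring, hence determined by its scalar
    matrices, whose classes in the limit already come from level 0. *)
Lemma mem_base_set (J : set (MC n R)) k (A : 'M[R]_(n ^ k)) :
  is_tsideal J -> J (MC_in A) <-> mx_in (base_set J) A.
Proof.
move=> idJ.
pose g := @dl_in (fun k => 'M[R]_(n ^ k)) (fun k => @blockdiag n R k) k.
have := is_tsideal_mxP A (is_tsideal_preimage g idJ).
by move=> /= ->; split=> AJ i j; move: (AJ i j);
   rewrite /base_set /= -(MC_in_scalar k).
Qed.

Lemma MC_tsidealK : cancel MC_tsideal base_tsideal.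
Proof.
move=> I; apply: tsideal_eqP; split=> r /=.
  (* At level 0 the matrix [r%:M] has [r] as its only entry. *)
  by move=> /mem_MC_set/(_ ord0 ord0); rewrite mxE eqxx.
move=> rI; apply/mem_MC_set => i j; rewrite mxE; case: eqP => // _.
exact: is_tsideal0 (tsidealP I).
Qed.

Lemma base_tsidealK : cancel base_tsideal MC_tsideal.
Proof.
(* Once [x] is represented at some level, both memberships say that the entries of [A] lie in
   [base_set J]. *)
move=> J; apply: tsideal_eqP; split=> x; have [k [A ->]] := dl_inP x.
  by move=> /mem_MC_set/(mem_base_set _ (tsidealP J)).
by move=> AJ; apply/mem_MC_set/(mem_base_set _ (tsidealP J)).
Qed.

End IdealCorrespondence.

Theorem proposition22 (n : nat) (R : pzRingType) (n_gt0 : (0 < n)%N) :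
  exists f : {lmorphism tsideal R -> tsideal (MC n R)}, bijective f.
Proof.
(* Only the monotonicity of the two maps for inclusion remains. *)
apply: (order_iso_lmorphism _ _ (MC_tsidealK n_gt0) (base_tsidealK n_gt0)).
  move=> I J /asboolP IJ; apply/asboolP => _ [k [A [-> AI]]].
  by exists k, A; split=> // i j; exact/IJ/AI.
by move=> I J /asboolP IJ; apply/asboolP => r; exact: IJ.
Qed.
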